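(* The infimum $\inf_{(G,S)} C(G,S)$ over all couples $(G,S)$, where $G$ is a finitely generated group and $S$ is a finite symmetric generating set of $G$, satisfies $$1\leq\inf_{(G,S)}C(G,S)\leq 2.$$
   Context: $|A|$ denotes the cardinality of a set $A$. For $x\in G$, $|x|_S=\min\{n\ge 0:\exists g_1,\dots,g_n\in S,\ x=g_1\cdots g_n\}$ (the empty product is the identity $e$). For real $r\ge 0$, $B_S(r)=\{x\in G:|x|_S\leq r\}$, and balls of negative radius are empty. $\Phi_S[v]=\inf\{r:|B_S(r)|>v\}$, with $\inf\emptyset=\infty$ and the convention $c/\infty=0$. For $\Omega\subset G$, $\partial_S\Omega=\{x\in\Omega:\exists s\in S,\ xs\in G\setminus\Omega\}$. The constant $C(G,S)\in[0,\infty]$ is $$C(G,S)=\sup\left\{c\geq 0:\exists \alpha\geq 0\text{ such that }\forall\Omega\subset G,\ \frac{|\partial_S\Omega|}{|\Omega|}\geq c\,\frac{1}{\Phi_S[(1+\alpha)|\Omega|]}\right\},$$ where $\Omega$ ranges over finite non-empty subsets of $G$. *)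

(* Defs.v *)
From mathcomp Require Import all_boot all_order all_algebra finmap.
From mathcomp Require Import all_classical all_reals all_analysis.

Set Implicit Arguments.
Unset Strict Implicit.
Unset Printing Implicit Defensive.

Import Order.TTheory GRing.Theory Num.Theory.

Local Open Scope classical_set_scope.
Local Open Scope ring_scope.

Section CayleyIsoperimetry.
Variables (R : realType) (G : groupType).
Implicit Types (S Omega : {fset G}) (x : G) (n : nat) (r v : R).

Definition symmetric_fset S : Prop := forall s, s \in S -> (s^-1)%g \in S.

Definition generates S : Prop :=
  forall H : {pred G}, group_closed H -> {subset S <= H} -> forall x, x \in H.

Definition product_of S n x : Prop :=
  exists w : seq G,
    [/\ size w = n, {subset w <= S} & x = (\prod_(g <- w) g)%g].

(* The infimum of a nonempty set of naturals is its minimum; the value is +oo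
   exactly when x is not a product of elements of S. *)
Definition word_length S x : \bar R :=
  ereal_inf [set n%:R%:E | n in [set n | product_of S n x]].

Definition word_ball S r : set G := [set x | (word_length S x <= r%:E)%E].

Definition Phi S v : \bar R :=
  ereal_inf [set r%:E | r in [set r | (v%:E < counting (word_ball S r))%E]].

Definition inner_boundary S Omega : {fset G} :=
  [fset x in Omega | `[< exists2 s, s \in S & (x * s)%g \notin Omega >]]%fset.

(* In \bar R the inverse of +oo is 0, and Phi S v >= 1 as soon as v >= 1, so
   the division by Phi below never meets 0. *)
Definition isoperimetric_bound S (c alpha : R) : Prop :=
  forall Omega, Omega != fset0 ->
    (c%:E / Phi S ((1 + alpha) * #|` Omega|%:R)
      <= (#|` inner_boundary S Omega|%:R / #|` Omega|%:R)%:E)%E.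

Definition isoperimetric_constant S : \bar R :=
  ereal_sup [set c%:E | c in
    [set c : R | 0 <= c /\
       exists alpha : R, 0 <= alpha /\ isoperimetric_bound S c alpha]].

End CayleyIsoperimetry.

Definition isoperimetric_constants (R : realType) : set (\bar R) :=
  [set C | exists (G : groupType) (S : {fset G}),
     [/\ symmetric_fset S, generates S & C = isoperimetric_constant R S]].

Arguments isoperimetric_constants R : clear implicits.

(* Main.v *)
From HB Require Import structures.
Require Import Defs.
From mathcomp Require Import all_boot all_order all_algebra finmap.
From mathcomp Require Import all_classical all_reals all_analysis.
From mathcomp Require Import ring lra zify.

(** The lower bound holds for every pair (G, S) by a counting argument.
    Suppose that a finite set X inside a ball of radius r has more than
    (1 + alpha) |Omega| elements. Each x in Omega is moved out of Omega by at
    least |X| - |Omega| elements of X, since x * X has only |Omega| places to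
    land in Omega ([sum_card_exits]). On the other hand, a product g of n
    generators moves at most n |d Omega| points out of Omega: the path from x
    to x * g spelled by a word for g leaves Omega through a boundary point, and
    x is recovered from that point and the time of exit ([card_exits_prod]).
    Comparing the two counts gives r |d Omega| >= alpha / (1 + alpha) |Omega|
    ([escape_bound]), so the constant alpha / (1 + alpha) is admissible for
    every alpha > 0, and its supremum is 1.

    The upper bound comes from the lamplighter group, with generators that move
    one step along the line and may toggle the lamp on the edge being crossed.
    The box of all (A, p) with lit lamps A among the n edges between the
    positions 0, ..., n and with p one of these positions has 2^n (n + 1)
    elements, and only those with p = 0 or p = n are on its boundary, so the
    boundary ratio is at most 2 / (n + 1). Walking r steps to the right already
    produces 2^r elements, so the ball of radius n + O(log n) has more than
    (1 + alpha) 2^n (n + 1) elements whatever alpha is. An admissible c thus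
    satisfies c <= 2 (n + O(log n)) / (n + 1), and c <= 2 in the limit
    ([isoperimetric_constant_le2]). *)

Set Implicit Arguments.
Unset Strict Implicit.
Unset Printing Implicit Defensive.

Import Order.TTheory GRing.Theory Num.Theory.

Local Open Scope classical_set_scope.
Local Open Scope ring_scope.

(** * Finite sets and counting *)

Lemma card_fset_filter (T : choiceType) (A : {fset T}) (P : pred T) :
  #|` [fset x in A | P x]%fset| = (\sum_(x <- A) P x)%N.
Proof.
have -> : (\sum_(x <- A) P x = \sum_(x <- A | P x) 1)%N.
  by rewrite [RHS]big_mkcond /=; apply: eq_bigr => x _; case: (P x).
rewrite sum1_count -size_filter; apply/perm_size/uniq_perm.
- exact: fset_uniq.
- by rewrite filter_uniq ?fset_uniq.
by move=> x; rewrite mem_filter !inE andbC.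
Qed.

Lemma card_fsetM (T U : choiceType) (A : {fset T}) (B : {fset U}) :
  #|` (A `*` B)%fset| = (#|` A| * #|` B|)%N.
Proof.
rewrite -(size_allpairs pair).
apply/perm_size/uniq_perm; first exact: fset_uniq.
  by rewrite allpairs_uniq ?fset_uniq// => -[? ?] [? ?].
move=> [x y]; rewrite in_fsetM; apply/andP/allpairsP => /=.
  by move=> [xA yB]; exists (x, y).
by move=> [[u v] [uA vB [-> ->]]].
Qed.

Lemma counting_gt_fset (R : realType) (T : choiceType) (A : set T) (v : R) :
  (v%:E < counting A)%E ->
  exists2 X : {fset T}, [set` X] `<=` A & v < #|` X|%:R.
Proof.
rewrite /counting; case: asboolP => [finA|infA _].
  by rewrite lte_fin => vA; exists (fset_set A); rewrite // fset_setK.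
have [X XA Xv] := infinite_set_fset (Num.truncn v).+1 infA.
by exists X; rewrite // (lt_le_trans (truncnS_gt v))// ler_nat.
Qed.

Lemma counting_ge_fset (R : realType) (T : choiceType) (A : set T)
    (X : {fset T}) :
  [set` X] `<=` A -> ((#|` X|%:R : R)%:E <= counting A)%E.
Proof.
move=> XA; rewrite /counting; case: asboolP => [finA|_]; last by rewrite leey.
rewrite lee_fin ler_nat fsubset_leq_card//; apply/fsubsetP => x xX.
by rewrite in_fset_set// inE; apply: XA.
Qed.

(** * The lower bound *)

Section Exits.
Variable G : groupType.
Implicit Types (S Omega X : {fset G}) (g x : G).

Definition exits Omega g : {fset G} :=
  [fset x in Omega | (x * g)%g \notin Omega]%fset.

(** Induction on the word: if x * (s * h) leaves Omega then either x * s already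
    does, and x is a boundary point, or x * s is one of the points of Omega
    that h moves out. *)
Lemma card_exits_prod S Omega (w : seq G) : {subset w <= S} ->
  (#|` exits Omega (\prod_(g <- w) g)%g|
     <= size w * #|` inner_boundary S Omega|)%N.
Proof.
elim: w => [|s w IHw] wS.
  rewrite big_nil leqn0 cardfs_eq0; apply/eqP/fsetP => x.
  by rewrite !inE mulg1 andbN.
rewrite big_cons /= mulSn.
have Ss : s \in S by apply: wS; rewrite mem_head.
have {}/IHw IHw : {subset w <= S} by move=> g gw; rewrite wS// in_cons gw orbT.
set h := (\prod_(g <- w) g)%g in IHw *.
have sub : (exits Omega (s * h)%g `<=`
    inner_boundary S Omega `|` [fset (y * s^-1)%g | y in exits Omega h])%fset.
  apply/fsubsetP => x; rewrite !inE => /andP[xO]; rewrite mulgA => xshO.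
  rewrite xO /=; case: (boolP ((x * s)%g \in Omega)) => xsO; apply/orP.
    right; apply/imfsetP; exists (x * s)%g; last by rewrite mulgK.
    by rewrite !inE xsO.
  by left; apply/asboolP; exists s.
apply: (leq_trans (fsubset_leq_card sub)).
rewrite cardfsU; apply: (leq_trans (leq_subr _ _)); rewrite leq_add2l.
by apply: leq_trans IHw; exact: leq_imfset_card.
Qed.

(** Stated without subtraction: the sum counts the pairs (x, g) in Omega * X with
    x * g outside Omega, and for fixed x left translation by x embeds the
    remaining g into Omega. *)
Lemma sum_card_exits Omega X :
  (#|` Omega| * #|` X|
     <= (\sum_(g <- X) #|` exits Omega g|) + #|` Omega| * #|` Omega|)%N.
Proof.
under eq_bigr do rewrite card_fset_filter.
rewrite exchange_big /= mulnC -[X in (_ * X)%N]sum1_size big_distrr /=.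
rewrite -[X in (_ + X * _)%N]sum1_size big_distrl -big_split /= leq_sum// => x _.
rewrite mul1n muln1 -sum1_size.
apply: (@leq_trans (\sum_(g <- X) (x * g \notin Omega)%g
                    + \sum_(g <- X) (x * g \in Omega)%g)%N).
  by rewrite -big_split /= leq_sum// => g _; case: (_ \in _).
rewrite leq_add2l -card_fset_filter.
have sub : ([fset (x * g)%g | g in [fset g in X | (x * g)%g \in Omega]]
              `<=` Omega)%fset.
  by apply/fsubsetP => y /imfsetP[g /=]; rewrite !inE => /andP[_ xgO] ->.
apply: leq_trans (fsubset_leq_card sub).
by rewrite [leqRHS]card_imfset//; exact: mulgI.
Qed.

End Exits.

Section WordMetric.
Variables (R : realType) (G : groupType).
Implicit Types (S Omega : {fset G}) (x : G) (r v : R).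

(** The infimum that defines the word length ranges over integers: when it is at
    most r, some member lies below the least integer greater than r. *)
Lemma word_ballP S r x :
  word_ball S r x <-> exists2 n, n%:R <= r & product_of S n x.
Proof.
split => [|[n nr nx]]; last first.
  by apply: ge_ereal_inf; exists n%:R%:E; rewrite ?lee_fin//; exists n.
rewrite /word_ball /= /word_length => inf_r.
have : (ereal_inf [set n%:R%:E | n in product_of S ^~ x] <
        (Num.truncn r).+1%:R%:E :> \bar R)%E.
  by apply: le_lt_trans inf_r _; rewrite lte_fin truncnS_gt.
move=> /ereal_inf_ltP[_ [n nx <-]]; rewrite lte_fin ltr_nat ltnS => n_r.
exists n => //; have [r0|r_lt0] := leP 0 r.
  by rewrite -truncn_ge_nat.
have : (0%:E <= r%:E :> \bar R)%E.
  by apply: le_trans inf_r; apply/ereal_infP => _ [m _ <-]; rewrite lee_fin.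
by rewrite lee_fin leNgt r_lt0.
Qed.

Lemma card_exits_ball S Omega r x : word_ball S r x ->
  #|` exits Omega x|%:R <= r * #|` inner_boundary S Omega|%:R.
Proof.
move=> /word_ballP[n nr [w [wn wS ->]]]; rewrite -wn in nr.
apply: le_trans (ler_wpM2r (ler0n _ _) nr).
by rewrite -natrM ler_nat card_exits_prod.
Qed.

(** Both counts of the pairs (x, g) with x * g outside Omega, for a finite part X
    of the ball with more than (1 + alpha) |Omega| elements. *)
Lemma escape_bound S Omega r (alpha : R) : 0 <= alpha ->
    (((1 + alpha) * #|` Omega|%:R)%:E < counting (word_ball S r))%E ->
  alpha * #|` Omega|%:R <= (1 + alpha) * (r * #|` inner_boundary S Omega|%:R).
Proof.
move=> alpha0 /counting_gt_fset[X XB].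
set w := (#|` Omega|%:R : R); set b := (#|` inner_boundary S Omega|%:R : R).
set m := (#|` X|%:R : R) => wm.
have w0 : 0 <= w by exact: ler0n.
have a1 : 0 < 1 + alpha by rewrite ltr_wpDr.
have m0 : 0 < m by apply: le_lt_trans wm; rewrite mulr_ge0// ltW.
have : w * m <= m * (r * b) + w * w.
  have := sum_card_exits Omega X; rewrite -(ler_nat R) natrD !natrM -/w -/m.
  move=> /le_trans; apply; rewrite lerD2r natr_sum.
  rewrite /m -sum1_size natr_sum mulr_suml big_seq [leRHS]big_seq.
  by apply: ler_sum => g gX; rewrite mul1r; apply: card_exits_ball; exact: XB.
move=> /(ler_wpM2l (ltW a1)) wm_le; have wwm := ler_wpM2l w0 (ltW wm).
rewrite -(ler_pM2l m0); lra.
Qed.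

(** Balls of negative radius are empty, hence never larger than v. *)
Lemma Phi_ge0 S v : 0 <= v -> (0 <= Phi S v)%E.
Proof.
move=> v0; apply/ereal_infP => _ [r /counting_gt_fset[X XB vX] <-].
have : (0 < #|` X|)%N by rewrite -(ltr_nat R) (le_lt_trans v0).
rewrite cardfs_gt0 => /fset0Pn[x /XB/word_ballP[n nr _]].
by rewrite lee_fin (le_trans _ nr).
Qed.

Lemma isoperimetric_bound_universal S (alpha : R) : 0 < alpha ->
  isoperimetric_bound S (alpha / (1 + alpha)) alpha.
Proof.
move=> alpha0 Omega Omega0.
set w := (#|` Omega|%:R : R); set b := (#|` inner_boundary S Omega|%:R : R).
have w0 : 0 < w by rewrite ltr0n cardfs_gt0.
have a1 : 0 < 1 + alpha by rewrite addr_gt0.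
have b_ge0 : 0 <= b by exact: ler0n.
set c := alpha / _; have c0 : 0 < c by rewrite divr_gt0.
have radius r : (((1 + alpha) * w)%:E < counting (word_ball S r))%E ->
    c * w <= r * b.
  move=> /(escape_bound (ltW alpha0)).
  by rewrite -/w -/b /c mulrAC ler_pdivrMr// [leRHS]mulrC.
have [b0|b_neq0] := eqVneq b 0.
  (* With no boundary no ball outgrows Omega, so Phi is infinite. *)
  have -> : Phi S ((1 + alpha) * w) = +oo%E.
    rewrite /Phi (_ : [set r | _] = set0) ?image_set0 ?ereal_inf0//.
    apply/seteqP; split => r //= /radius.
    by rewrite b0 mulr0 leNgt mulr_gt0.
  by rewrite invey mule0 lee_fin divr_ge0// ltW.
have {b_ge0 b_neq0} b0 : 0 < b by rewrite lt_neqAle eq_sym b_neq0.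
have Phi_ge : ((c * w / b)%:E <= Phi S ((1 + alpha) * w))%E.
  apply/ereal_infP => _ [r /radius wr <-].
  by rewrite lee_fin ler_pdivrMr.
have cwb0 : 0 < c * w / b by rewrite divr_gt0// mulr_gt0.
apply: (@le_trans _ _ (c%:E * (c * w / b)^-1%:E)%E).
  rewrite lee_pmul2l// (_ : (_^-1)%:E = ((c * w / b)%:E^-1)%E); last first.
    by rewrite inver gt_eqF.
  rewrite lee_pV2// inE/= ?lee_fin ?(ltW cwb0)//.
  by rewrite Phi_ge0// mulr_ge0// ltW.
rewrite -EFinM lee_fin invf_div mulrC -mulrA invfM [X in _ * X]mulrAC.
by rewrite mulVf ?mul1r ?gt_eqF.
Qed.

(** The value alpha = 1 / e gives the admissible constant 1 / (1 + e), which is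
    at least 1 - e. *)
Lemma isoperimetric_constant_ge1 S : (1 <= isoperimetric_constant R S)%E.
Proof.
apply/lee_addgt0Pr => e e0; rewrite -leeBlDr//.
have i0 : 0 < e^-1 by rewrite invr_gt0.
apply: (@le_trans _ _ (e^-1 / (1 + e^-1))%:E); last first.
  apply: ereal_sup_ubound; exists (e^-1 / (1 + e^-1)) => //; split.
    by rewrite divr_ge0 ?addr_ge0 ?ltW.
  by exists e^-1; split; [exact: ltW|exact: isoperimetric_bound_universal].
rewrite lee_fin ler_pdivlMr ?addr_gt0//.
have -> : (1 - e) * (1 + e^-1) = e^-1 - e by field; rewrite gt_eqF.
by rewrite gerBl ltW.
Qed.

End WordMetric.

(** * Test sets and upper bounds *)

Section TestSets.
Variables (R : realType) (G : groupType) (S : {fset G}).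
Implicit Types (Omega X : {fset G}) (c alpha r : R).

(** The converse use of the inequality: one large subset of a ball bounds Phi
    from above, and so bounds every admissible c. *)
Lemma isoperimetric_bound_test c alpha Omega X r :
    isoperimetric_bound S c alpha -> 0 <= c -> 0 <= alpha -> 0 < r ->
    Omega != fset0 ->
    [set` X] `<=` word_ball S r -> (1 + alpha) * #|` Omega|%:R < #|` X|%:R ->
  c * #|` Omega|%:R <= r * #|` inner_boundary S Omega|%:R.
Proof.
move=> bnd c0 alpha0 r0 Omega0 /(counting_ge_fset R) XB wX.
have w0 : 0 < #|` Omega|%:R :> R by rewrite ltr0n cardfs_gt0.
have := bnd _ Omega0; set v := (1 + alpha) * _ in wX *.
have Phi_r : (Phi S v <= r%:E)%E.
  apply: ge_ereal_inf; exists r%:E => //; exists r => //=.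
  by apply: lt_le_trans XB; rewrite lte_fin.
have : (c%:E / r%:E <= c%:E / Phi S v)%E.
  rewrite lee_wpmul2l// lee_pV2// inE/= ?lee_fin ?(ltW r0)//.
  by apply: Phi_ge0; rewrite mulr_ge0// addr_ge0.
move=> /le_trans/[apply]; rewrite inver gt_eqF// -EFinM lee_fin.
by rewrite ler_pdivrMr// mulrAC ler_pdivlMr// [leRHS]mulrC.
Qed.

(** Ball growth at rate 2 absorbs any factor 1 + alpha: the subset X m of the
    ball of radius m outgrows (1 + alpha) |Omega n| as soon as
    m > n + log2 (n + 1) + log2 (1 + alpha), which is n + o(n). *)
Lemma isoperimetric_constant_le2 (Omega X : nat -> {fset G}) :
    (forall n, #|` Omega n| = 2 ^ n * n.+1)%N ->
    (forall n, #|` inner_boundary S (Omega n)| <= 2 ^ n * 2)%N ->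
    (forall n, #|` X n| = 2 ^ n)%N ->
    (forall n x, x \in X n -> product_of S n x) ->
  (isoperimetric_constant R S <= 2)%E.
Proof.
move=> cardO cardB cardX XS.
apply/ereal_supP => _ [c [c0 [alpha [alpha0 bnd]]] <-].
rewrite lee_fin leNgt; apply/negP => c2.
pose a := (Num.truncn (1 + alpha)).+1.
have alpha_lt : 1 + alpha < (2 ^ a)%:R.
  by rewrite (lt_le_trans (truncnS_gt _))// ler_nat ltnW// ltn_expl.
(* The test set of index 2 ^ j - 1, for which log2 (n + 1) is exactly j. *)
have key j : c * (2 ^ j)%:R <= 2 * (2 ^ j + j + a)%:R.
  pose n := (2 ^ j).-1; have nE : n.+1 = (2 ^ j)%N by rewrite prednK ?expn_gt0.
  have := @isoperimetric_bound_test c alpha (Omega n) (X (n + (j + a))%N)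
    (n + (j + a))%:R bnd c0 alpha0.
  have -> : 0 < (n + (j + a))%:R :> R by rewrite ltr0n !addnS.
  have -> : Omega n != fset0 by rewrite -cardfs_gt0 cardO muln_gt0 expn_gt0.
  move=> /(_ isT isT); rewrite cardO cardX nE.
  have XB : [set` X (n + (j + a))%N] `<=` word_ball S ((n + (j + a))%:R : R).
    by move=> x xX; apply/word_ballP; exists (n + (j + a))%N => //; exact: XS.
  move=> /(_ XB); rewrite !expnD !natrM.
  set e := ((2 ^ n)%:R : R); have e0 : 0 < e by rewrite ltr0n expn_gt0.
  set f := ((2 ^ j)%:R : R); have f0 : 0 < f by rewrite ltr0n expn_gt0.
  have -> : (1 + alpha) * (e * f) < e * (f * (2 ^ a)%:R).
    by rewrite mulrCA ltr_pM2l// mulrC ltr_pM2l.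
  move=> /(_ isT); have := cardB n; rewrite -(ler_nat R) natrM -/e => cB.
  have n0 : 0 <= (n + (j + a))%:R :> R by rewrite ler0n.
  move=> /le_trans/(_ (ler_wpM2l n0 cB)) cef.
  apply: (@le_trans _ _ (2 * (n + (j + a))%:R)).
    by rewrite -(ler_pM2l e0); lra.
  by rewrite ler_pM2l// ler_nat addnA !leq_add2r leq_pred.
(* The index 2 * j gives a quadratic lower bound 2 ^ (2 j) >= (j + 1) ^ 2 against
   a linear error term; one factor j + 1 is then cancelled. *)
have lin j : (c - 2) * (j.+1%:R) <= 2 * (2 + a%:R).
  have j0 : 0 < j.+1%:R :> R by rewrite ltr0n.
  have := key (j + j)%N; rewrite expnD !natrD => h.
  have h' : (c - 2) * (j.+1%:R * j.+1%:R) <= (c - 2) * (2 ^ j * 2 ^ j)%:R.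
    by rewrite ler_pM2l ?subr_gt0// -natrM ler_nat leq_mul// ltn_expl.
  have aj : 0 <= a%:R * j%:R :> R by rewrite mulr_ge0.
  have a0 : 0 <= a%:R :> R by [].
  by rewrite -(ler_pM2r j0); move: h'; rewrite -[j.+1]addn1 natrD; lra.
pose j := Num.truncn (2 * (2 + a%:R) / (c - 2)).
have := lin j; rewrite leNgt => /negP; apply.
by rewrite [ltRHS]mulrC -ltr_pdivrMr ?subr_gt0// truncnS_gt.
Qed.
End TestSets.

(** * The lamplighter group *)

Lemma product_of_mulr (G : groupType) (S : {fset G}) n x s :
  product_of S n x -> s \in S -> product_of S n.+1 (x * s)%g.
Proof.
move=> [w [wn wS ->]] sS; exists (rcons w s); split.
- by rewrite size_rcons wn.
- by move=> g; rewrite mem_rcons in_cons => /predU1P[->//|/wS].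
- by rewrite -cats1 big_cat big_seq1.
Qed.

Section Lamplighter.
Implicit Types (A B : {fset int}) (k l x : int).

Definition symdiff A B : {fset int} := (A `\` B `|` B `\` A)%fset.
Definition shift k A : {fset int} := [fset (x + k)%R | x in A]%fset.

Lemma in_symdiff A B x : (x \in symdiff A B) = (x \in A) (+) (x \in B).
Proof. by rewrite !inE; case: (x \in A); case: (x \in B). Qed.

Lemma in_shift k A x : (x \in shift k A) = (x - k \in A).
Proof.
apply/imfsetP/idP => [[y /= yA ->]|xkA]; first by rewrite addrK.
by exists (x - k); rewrite ?subrK.
Qed.

(** The restricted wreath product of Z/2 by Z: a finite set of lit lamps and the
    position of the lamplighter. *)
Definition lamplighter : Type := ({fset int} * int)%type.
HB.instance Definition _ := Choice.on lamplighter.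

Definition lamp_one : lamplighter := (fset0, 0).
Definition lamp_inv (g : lamplighter) : lamplighter :=
  (shift (- g.2) g.1, - g.2).
Definition lamp_mul (g h : lamplighter) : lamplighter :=
  (symdiff g.1 (shift g.2 h.1), g.2 + h.2).

Lemma lamp_eq (g h : lamplighter) : g.1 =i h.1 -> g.2 = h.2 -> g = h.
Proof. by case: g h => A k [B l] /= /fsetP -> ->. Qed.

Lemma lamp_mulA : associative lamp_mul.
Proof.
move=> g h i; apply: lamp_eq => [x|]; last by rewrite /= addrA.
by rewrite /= !(in_symdiff, in_shift) opprD addrA addbA addrAC.
Qed.

Lemma lamp_mul1 : left_id lamp_one lamp_mul.
Proof.
move=> g; apply: lamp_eq => [x|]; last by rewrite /= add0r.
by rewrite /= in_symdiff in_shift subr0.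
Qed.

Lemma lamp_mulr1 : right_id lamp_one lamp_mul.
Proof.
move=> g; apply: lamp_eq => [x|]; last by rewrite /= addr0.
by rewrite /= in_symdiff in_shift inE addbF.
Qed.

Lemma lamp_mulV : left_inverse lamp_one lamp_inv lamp_mul.
Proof.
move=> g; apply: lamp_eq => [x|]; last by rewrite /= addNr.
by rewrite /= in_symdiff !in_shift opprK addbb inE.
Qed.

Lemma lamp_mulrV : right_inverse lamp_one lamp_inv lamp_mul.
Proof.
move=> g; apply: lamp_eq => [x|]; last by rewrite /= subrr.
by rewrite /= in_symdiff !in_shift opprK subrK addbb inE.
Qed.

HB.instance Definition _ := isGroup.Build lamplighter
  lamp_mulA lamp_mul1 lamp_mulr1 lamp_mulV lamp_mulrV.

(** Lamp i is read as sitting on the edge from i to i + 1. The generators cross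
    one edge, to the right or to the left, and toggle its lamp or not; the
    switched edge is 0 for a step to the right and -1 for a step to the left. *)
Definition lamp_gens : {fset lamplighter} :=
  [fset ((fset0, 1) : lamplighter); ([fset 0], 1);
        (fset0, -1); ([fset -1], -1)]%fset.

Lemma lamp_gensP (s : lamplighter) : s \in lamp_gens ->
  [\/ s = (fset0, 1), s = ([fset 0]%fset, 1),
      s = (fset0, -1) | s = ([fset -1]%fset, -1)].
Proof.
by rewrite !inE => /orP[/orP[/orP[]|]|] /eqP ->;
  [apply: Or41|apply: Or42|apply: Or43|apply: Or44].
Qed.

Lemma lamp_gens_symmetric : symmetric_fset lamp_gens.
Proof.
have invE A k : ((A, k) : lamplighter)^-1%g = (shift (- k) A, - k) by [].
have shift0 k : shift k fset0 = fset0.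
  by apply/fsetP => x; rewrite in_shift !inE.
have shift1 k l : shift k [fset l]%fset = [fset (l + k)%R]%fset.
  by apply/fsetP => x; rewrite in_shift !inE subr_eq.
by move=> s /lamp_gensP[] ->; rewrite invE ?shift0 ?shift1 ?opprK !inE eqxx ?orbT.
Qed.

(** Powers of the plain step give all translations, stepping right with a toggle
    and back without one switches lamp 0, and conjugating by translations
    switches any other lamp. *)
Lemma lamp_gens_generate : generates lamp_gens.
Proof.
move=> H Hgrp SH.
have HM := group_closedM Hgrp; have HV := group_closedV Hgrp.
have T1 : ((fset0, 1) : lamplighter) \in H by apply: SH; rewrite !inE eqxx.
have T k : ((fset0, k) : lamplighter) \in H.
  have Tn n : ((fset0, n%:Z) : lamplighter) \in H.
    elim: n => [|n IHn]; first exact: Hgrp.1.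
    have := HM _ _ IHn T1; congr (_ \in H); apply: lamp_eq => [x|] /=.
      by rewrite in_symdiff in_shift !inE.
    by rewrite -addn1 PoszD.
  case: k => n //; have := HV _ (Tn n.+1); congr (_ \in H).
  by apply: lamp_eq => [x|]; rewrite //= in_shift !inE.
have lamp i : (([fset i]%fset, 0) : lamplighter) \in H.
  have a : (([fset 0]%fset, 1) : lamplighter) \in H.
    by apply: SH; rewrite !inE eqxx orbT.
  have := HM _ _ (HM _ _ (T i) a) (T (- (i + 1))); congr (_ \in H).
  apply: lamp_eq => [x|] /=; last by rewrite subrr.
  by rewrite !(in_symdiff, in_shift) !inE subr_eq0 addbF.
have lamps A : ((A, 0) : lamplighter) \in H.
  elim/finSet_rect: A => A IH; have [->|/fset0Pn[i iA]] := eqVneq A fset0.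
    exact: Hgrp.1.
  have := HM _ _ (lamp i) (IH _ (fproperD1 iA)); congr (_ \in H).
  apply: lamp_eq => [x|] //=.
  by rewrite !(in_symdiff, in_shift) !inE subr0; case: eqVneq => [->|].
move=> [A k]; have := HM _ _ (lamps A) (T k); congr (_ \in H).
apply: lamp_eq => [x|] /=; last by rewrite add0r.
by rewrite !(in_symdiff, in_shift) !inE addbF.
Qed.

(** Both the first n edges and the first n positions to the right of 0. *)
Definition segment n : {fset int} := [fset Posz i | i in iota 0 n]%fset.

Lemma in_segment n x : (x \in segment n) = (0 <= x < n%:Z).
Proof.
apply/imfsetP/idP => [[i /=]|].
  by rewrite mem_iota add0n => /andP[_ i_n] ->; rewrite ltz_nat.
by case: x => // i /= i_n; exists i => //=; rewrite mem_iota add0n.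
Qed.

Lemma card_segment n : #|` segment n| = n.
Proof.
rewrite card_in_imfset => [|i j _ _ [->]] //=.
by rewrite undup_id ?iota_uniq // size_iota.
Qed.

Definition lamp_box n : {fset lamplighter} :=
  (fpowerset (segment n) `*` segment n.+1)%fset.

Lemma card_lamp_box n : #|` lamp_box n| = (2 ^ n * n.+1)%N.
Proof. by rewrite card_fsetM card_fpowerset !card_segment. Qed.

Lemma in_lamp_box n (A : {fset int}) p :
  (((A, p) : lamplighter) \in lamp_box n) =
  (A `<=` segment n)%fset && (0 <= p < n.+1%:Z).
Proof. by rewrite in_fsetM fpowersetE in_segment. Qed.

(** From a position strictly inside the box, both neighbouring positions and
    both adjacent edges belong to the box, so no generator leaves it. *)
Lemma card_boundary_lamp_box n :
  (#|` inner_boundary lamp_gens (lamp_box n)| <= 2 ^ n * 2)%N.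
Proof.
have sub : (inner_boundary lamp_gens (lamp_box n) `<=`
            fpowerset (segment n) `*` [fset 0; n%:Z])%fset.
  apply/fsubsetP => -[A p]; rewrite !inE /= fpowersetE in_segment.
  move=> /andP[/andP[An pn]].
  move=> /asboolP[s sS] out; rewrite An /=.
  apply: contraNT out; rewrite negb_or => /andP[p0 pN].
  have flip (B : {fset int}) :
      (forall x, x \in shift p B -> x = p \/ x = p - 1) ->
      (symdiff A (shift p B) `<=` segment n)%fset.
    move=> Bp; apply/fsubsetP => x; rewrite in_symdiff in_segment.
    case: (boolP (x \in A)) => [/(fsubsetP An)|_]; first by rewrite in_segment.
    by move=> /Bp; lia.
  by case/lamp_gensP: sS => ->; rewrite [(_ * _)%g]/(lamp_mul _ _) /lamp_mul /=
    in_lamp_box flip /=; (try lia) => x; rewrite in_shift !inE; lia.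
apply: leq_trans (fsubset_leq_card sub) _.
by rewrite card_fsetM card_fpowerset card_segment leq_mul// cardfs2; case: eqVneq.
Qed.

(** The configurations reachable from the identity by n steps to the right. *)
Definition lamp_sweep n : {fset lamplighter} :=
  (fpowerset (segment n) `*` [fset n%:Z])%fset.

Lemma card_lamp_sweep n : #|` lamp_sweep n| = (2 ^ n)%N.
Proof. by rewrite card_fsetM card_fpowerset card_segment cardfs1 muln1. Qed.

(** Each edge is crossed exactly once, and its lamp takes its final state at that
    moment; step n + 1 takes care of lamp n. *)
Lemma lamp_sweep_product n g : g \in lamp_sweep n -> product_of lamp_gens n g.
Proof.
case: g => A p; rewrite in_fsetM fpowersetE inE => /= /andP[+ /eqP ->].
elim: n A => [|n IHn] A An.
  exists [::]; split => //; rewrite big_nil; apply: lamp_eq => //= x; rewrite inE.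
  by apply/negP => /(fsubsetP An); rewrite in_segment; lia.
pose s : lamplighter := (if n%:Z \in A then [fset 0]%fset else fset0, 1).
have sS : s \in lamp_gens by rewrite /s !inE; case: ifP; rewrite eqxx ?orbT.
have Bn : (A `\ n%:Z `<=` segment n)%fset.
  apply/fsubsetP => x; rewrite !inE in_segment => /andP[xn /(fsubsetP An)].
  by rewrite in_segment; lia.
have := product_of_mulr (IHn _ Bn) sS; congr product_of.
apply: lamp_eq => [x|] /=; last by rewrite -PoszD addn1.
rewrite in_symdiff in_shift !inE.
have -> : (x - n%:Z \in (if n%:Z \in A then [fset 0] else fset0)%fset)
        = (n%:Z \in A) && (x == n%:Z).
  by case: ifP; rewrite !inE ?subr_eq0.
by case: eqVneq => [->|_]; rewrite ?andbT ?andbF ?addbF.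
Qed.

End Lamplighter.

(** * Bounds on the infimum *)

Local Open Scope ereal_scope.

Theorem theorem3p11 (R : realType) :
  1 <= ereal_inf (isoperimetric_constants R) /\
  ereal_inf (isoperimetric_constants R) <= 2.
Proof.
split.
  by apply/ereal_infP => _ [G [S [_ _ ->]]]; exact: isoperimetric_constant_ge1.
apply: ge_ereal_inf; exists (isoperimetric_constant R lamp_gens).
  exists lamplighter, lamp_gens; split => //.
  - exact: lamp_gens_symmetric.
  - exact: lamp_gens_generate.
exact: (isoperimetric_constant_le2 R card_lamp_box card_boundary_lamp_box
  card_lamp_sweep lamp_sweep_product).
Qed.
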